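(* For any integer $k>1$ and every $\alpha\in\mathbb{Q}\setminus\mathbb{Z}$, the series $$\sum_{n=-\infty}^{+\infty}\frac{1}{(n+\alpha)^k}$$ is either null or an algebraic multiple of $\pi^k$ (that is, an algebraic number times $\pi^k$). Moreover, it is null if and only if $k$ is odd and $\alpha$ is a half-integer.
   Context: A half-integer is a number of the form $m+\frac12$ with $m\in\mathbb{Z}$. ''Null'' means that the sum equals $0$. The bilateral series is over all $n\in\mathbb{Z}$ and converges absolutely. *)

(* Defs.v *)
From HB Require Import structures.
From mathcomp Require Import all_boot all_order all_algebra.
From mathcomp Require Import all_classical all_reals all_analysis.

Set Implicit Arguments.
Unset Strict Implicit.
Unset Printing Implicit Defensive.

Import Order.TTheory GRing.Theory Num.Theory.
Import numFieldNormedType.Exports.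

Local Open Scope classical_set_scope.
Local Open Scope ring_scope.

(* The partial sum u_(-M) + ... + u_(-1) + u_0 + ... + u_(N-1), where
   MN = (M, N). *)
Definition bipartial (R : realType) (u : int -> R) (MN : nat * nat) : R :=
  \sum_(i < MN.1) u (- (i.+1)%:Z) + \sum_(i < MN.2) u i%:Z.

(* The two ends tend to infinity independently of each other: this is not the
   limit of the symmetric partial sums. *)
Definition bicvg (R : realType) (u : int -> R) : Prop :=
  cvg (bipartial u @ (\oo, \oo)).

(* Meaningful only under [bicvg u], as [lim] is a total operator. *)
Definition bisum (R : realType) (u : int -> R) : R :=
  lim (bipartial u @ (\oo, \oo)).

Definition half_integer (a : rat) : Prop :=
  exists m : int, a = m%:~R + 1 / 2%:R.

(* Algebraic over the prime field Q; a real number is algebraic over Q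
   regardless of whether it is seen in R or in C. *)
Definition algebraic_number (R : realType) (x : R) : Prop :=
  algebraicOver (ratr : rat -> R) x.

Definition shifted_term (R : realType) (k : nat) (a : rat) (n : int) : R :=
  1 / (n%:~R + ratr a) ^+ k.

(* Main.v *)
Require Import Defs.
From HB Require Import structures.
From mathcomp Require Import all_boot all_order all_algebra.
From mathcomp Require Import all_classical all_reals all_analysis.
From mathcomp Require Import zify ring lra.

Import Order.TTheory GRing.Theory Num.Theory.
Import numFieldNormedType.Exports.

Local Open Scope classical_set_scope.
Local Open Scope ring_scope.

Set Implicit Arguments.
Unset Strict Implicit.
Unset Printing Implicit Defensive.

(** Write k = n + 1.  The n-th derivative of cot is (-1)^n n! P_n(cot) for the
polynomials P_0 = X, P_(n+1) = (1 + X^2) P_n' / (n + 1), which have rational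
coefficients.  The theorem rests on the classical formula, for 0 < x < 1,
  sum over all integers j of 1 / (j + x)^k  =  pi^k P_n(cot(pi x))
together with a sign argument for the zeros.

The formula is proved without differentiating a series under the sum sign.
Since cot y is the mean of cot(y/2) and cot((y + pi)/2), differentiating this
identity n times gives P_n(cot(y/2)) + P_n(cot((y + pi)/2)) = 2^k P_n(cot y);
in the variable t = cot(y/2) it is an identity of rational functions
([cot_poly_half]).  Iterating it m times expresses P_n(cot(pi x)) as
(1 / 2M)^k times the sum of P_n(cot(pi (x + j) / 2M)) over -M <= j < M, where
M = 2^(m-1) ([cot_poly_sum_sym]).  As P_n is monic of degree k and z cot z
tends to 1 at 0, the j-th term times (pi / 2M)^k tends to 1 / (x + j)^k; as
|z cot z| <= 1 for |z| <= pi / 2, it is bounded by C / |x + j|^k uniformly in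
M.  Dominated convergence for series ([tannery]) then yields the formula
([hurwitz_reflection]).

When x is rational, cot(pi x) is algebraic ([algebraic_cot]): the sine of a
multiple d t is (sin t)^d times a rational polynomial in cot t, and it vanishes
at t = pi x when d is a denominator of x.  Hence P_n(cot(pi x)) is algebraic.

For the zeros, split the bilateral sum at 0: it equals h(x) + (-1)^k h(1 - x),
where h is the Hurwitz zeta function at k, which is positive and strictly
decreasing.  So the sum is positive for k even, and for k odd it vanishes
exactly when x = 1 - x ([hurwitz_reflection_eq0]).

A general alpha is an integer translate of a rational in ]0, 1[, and translating
the index does not change a bilateral sum ([bilateral_sum_shift]). *)

(** * The polynomials of the derivatives of cot *)

(** The polynomial P with (d/dz)^n cot z = (-1)^n n! P(cot z); the factor
(1 + X^2) comes from cot' = - (1 + cot^2). *)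
Fixpoint cot_poly (F : fieldType) (n : nat) : {poly F} :=
  if n is m.+1 then m.+1%:R^-1 *: ((1 + 'X^2) * (cot_poly F m)^`()) else 'X.

Lemma map_cot_poly (F E : fieldType) (f : {rmorphism F -> E}) (n : nat) :
  map_poly f (cot_poly F n) = cot_poly E n.
Proof.
elim: n => [|n IHn] /=; first exact: map_polyX.
by rewrite map_polyZ fmorphV rmorph_nat rmorphM rmorphD rmorph1 /= map_polyXn
  -deriv_map IHn.
Qed.

Lemma size_cot_poly (F : fieldType) (n : nat) :
  (size (cot_poly F n) <= n.+2)%N.
Proof.
elim: n => [|n IHn] /=; first by rewrite size_polyX.
apply: leq_trans (size_scale_leq _ _) _.
apply: leq_trans (size_polyMleq _ _) _.
have sd : (size (cot_poly F n)^`() <= n.+1)%N.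
  by rewrite (leq_trans (size_poly _ _)) //; case: (size _) IHn.
have s2 : (size (1 + 'X^2 : {poly F})%R <= 3)%N.
  by rewrite (leq_trans (size_polyD _ _)) // size_polyXn size_poly1.
by have := leq_add s2 sd; case: (_ + _)%N.
Qed.

Lemma lead_cot_poly (F : numFieldType) (n : nat) : (cot_poly F n)`_n.+1 = 1.
Proof.
elim: n => [|n IHn] /=; first by rewrite coefX.
rewrite coefZ mulrDl mul1r coefD coefXnM /= !coef_deriv subn2 /= IHn.
rewrite nth_default ?(leq_trans (size_cot_poly F n)) //.
by rewrite mul0rn add0r mulVf // pnatr_eq0.
Qed.

(** With t = cot w, one has cot(w + pi/2) = - 1/t and cot(2 w) = (t - 1/t) / 2.
For n = 0 this is the duplication formula of cot; each further case follows by
differentiating in t and multiplying by (1 + t^2) / (n + 1), because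
1 + ((t - 1/t) / 2)^2 = ((t + 1/t) / 2)^2. *)
Lemma cot_poly_half (R : realType) (n : nat) (t : R) : t != 0 ->
  (cot_poly R n).[t] + (cot_poly R n).[- t^-1] =
  2 ^+ n.+1 * (cot_poly R n).[(t - t^-1) / 2].
Proof.
elim: n t => [|n IHn] t t0.
  by rewrite /= !hornerX expr1; field.
pose P := cot_poly R n.
have dV : is_derive t 1 (fun s : R => - s^-1) (t ^- 2).
  apply: is_derive_eq; first exact: (is_deriveN (is_deriveV t0 _)).
  by rewrite /= scaler1 opprK.
have dH : is_derive t 1 (fun s : R => (s - s^-1) / 2) ((1 + t ^- 2) / 2).
  apply: is_derive_eq.
  by rewrite /= !scaler0 add0r /GRing.scale /= mulrC.
have df := is_deriveD (is_derive_poly P t) (@is_derive1_comp R (horner P)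
  (fun s => - s^-1) t _ _ (is_derive_poly P (- t^-1)) dV).
have dg := is_deriveZ (2 ^+ n.+1) (@is_derive1_comp R (horner P)
  (fun s => (s - s^-1) / 2) t _ _ (is_derive_poly P ((t - t^-1) / 2)) dH).
move: df dg.
set f := (X in is_derive _ _ X _ -> _).
set g := (X in _ -> is_derive _ _ X _ -> _).
move=> df dg.
(* The identity holds on a neighbourhood of t, as t is nonzero. *)
have fg : 'D_1 f t = 'D_1 g t.
  apply: near_eq_derive; near=> s; apply: IHn.
  by near: s; exact: (open_nbhs_nbhs (conj (@open_neq R 0) t0)).
move: fg; rewrite (@derive_val _ _ _ _ _ _ _ df) (@derive_val _ _ _ _ _ _ _ dg).
have d0 : n.+1%:R != 0 :> R by rewrite pnatr_eq0.
rewrite [cot_poly R n.+1]/= -/P !hornerE /= (exprS 2 n.+1) /GRing.scale /=.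
move: (P^`().[t]) (P^`().[- t^-1]) (P^`().[_ / 2]) (2 ^+ n.+1) (n.+1%:R) d0.
move=> a b c e d d0 /(canRL (addrK _)) ->; field.
by rewrite t0 d0.
Unshelve. all: by end_near. Qed.

(** * Dyadic duplication of cot *)

Definition cot (R : realType) (z : R) : R := cos z / sin z.

Lemma cotDpi (R : realType) (z : R) : cot (z + pi) = cot z.
Proof. by rewrite /cot cosDpi sinDpi invrN mulrNN. Qed.

Lemma cot_poly_cot_half (R : realType) (n : nat) (z : R) : sin z != 0 ->
  (cot_poly R n).[cot (z / 2)] + (cot_poly R n).[cot (z / 2 + pi / 2)] =
  2 ^+ n.+1 * (cot_poly R n).[cot z].
Proof.
move=> sz; set w := z / 2.
have zE : z = w *+ 2 by rewrite /w -mulr_natr divfK // pnatr_eq0.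
have [cw sw] : cos w != 0 /\ sin w != 0.
  move: sz; rewrite zE sin_mulr2n mulrn_eq0 /= mulf_eq0 negb_or.
  by move=> /andP[].
have -> : cot (w + pi / 2) = - (cot w)^-1.
  by rewrite /cot cosDpihalf sinDpihalf invf_div mulNr.
rewrite cot_poly_half ?mulf_neq0 ?invr_neq0 //.
congr (_ * _.[_]); rewrite zE /cot sin_mulr2n cos_mulr2n.
have -> : cos w ^+ 2 *+ 2 - 1 = cos w ^+ 2 - sin w ^+ 2.
  by rewrite sin2cos2; ring.
by field; rewrite cw sw.
Qed.

(** The arguments y + i pi are halved m times; keeping y in ]0, pi[ keeps every
intermediate argument there, away from the poles of cot. *)
Lemma cot_poly_sum (R : realType) (n m : nat) (y : R) : 0 < y < pi ->
  \sum_(i < 2 ^ m) (cot_poly R n).[cot ((y + i%:R * pi) / 2 ^+ m)] =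
  (2 ^+ m) ^+ n.+1 * (cot_poly R n).[cot y].
Proof.
move=> /andP[y0 ypi]; elim: m => [|m IHm].
  rewrite expn0 big_ord_recl big_ord0 expr0 expr1n /=.
  by rewrite mul0r !addr0 divr1 mul1r.
have t0 : (2 : R) ^+ m != 0 by rewrite expf_neq0 // pnatr_eq0.
rewrite expnS mul2n -addnn big_split_ord /= -big_split /=.
rewrite [RHS](_ : _ = 2 ^+ n.+1 * ((2 ^+ m) ^+ n.+1 * (cot_poly R n).[cot y]));
  last by rewrite mulrA -exprMn -exprS.
rewrite -IHm big_distrr /=; apply: eq_bigr => i _.
rewrite -cot_poly_cot_half; last first.
  rewrite gt_eqF // sin_gt0_pi // divr_gt0 ?exprn_gt0 //=; last first.
    by rewrite ltr_pwDl // mulr_ge0 // pi_ge0.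
  rewrite ltr_pdivrMr ?exprn_gt0 // -natrX.
  have : i.+1%:R <= (2 ^ m)%:R :> R by rewrite ler_nat.
  by rewrite -natr1; have := @pi_gt0 R; nra.
congr (_.[cot _] + _.[cot _]); first by rewrite exprS; field.
by rewrite natrD natrX exprS; field.
Qed.

(** The upper half of the indices is moved to the negative side by the period
pi: the index 2M - 1 - i becomes - (i + 1).  The arguments then stay in
]- pi/2, pi/2[, where z cot z is bounded. *)
Lemma cot_poly_sum_sym (R : realType) (n m : nat) (y : R) : 0 < y < pi ->
  \sum_(i < 2 ^ m) (cot_poly R n).[cot ((y - i.+1%:R * pi) / 2 ^+ m.+1)] +
  \sum_(i < 2 ^ m) (cot_poly R n).[cot ((y + i%:R * pi) / 2 ^+ m.+1)] =
  (2 ^+ m.+1) ^+ n.+1 * (cot_poly R n).[cot y].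
Proof.
move=> hy; rewrite -cot_poly_sum // expnS mul2n -addnn big_split_ord /= addrC.
congr (_ + _); rewrite [RHS](reindex_inj rev_ord_inj) /=.
apply: eq_bigr => i _; rewrite -[in LHS]cotDpi; congr (_.[cot _]).
have t0 : (2 : R) ^+ m != 0 by rewrite expf_neq0 // pnatr_eq0.
by rewrite natrD natrB ?ltn_ord // natrX exprS; field.
Qed.

(** * The pole of cot at 0 *)

Lemma cotN (R : realType) (z : R) : cot (- z) = - cot z.
Proof. by rewrite /cot cosN sinN invrN mulrN. Qed.

(** The derivative of sin z - z cos z is z sin z, nonnegative on [0, pi]. *)
Lemma le_mul_cos_sin (R : realType) (z : R) : 0 <= z <= pi / 2 ->
  z * cos z <= sin z.
Proof.
move=> /andP[z0 zpi].
pose f : R -> R := sin - id * cos.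
have df (x : R) : is_derive x 1 f (x * sin x).
  apply: is_derive_eq; rewrite /GRing.scale /=; ring.
have : f 0 <= f z.
  have fc : {within `[0, z], continuous f}.
    by apply: derivable_within_continuous => x _; exact: ex_derive.
  have [c] := @MVT_segment R f (fun x => x * sin x) 0 z z0 (fun x _ => df x) fc.
  rewrite in_itv /= => /andP[c0 cz] /eqP; rewrite -subr_ge0 => /eqP ->.
  rewrite subr0 !mulr_ge0 // sin_ge0_pi // c0 /=.
  by have := @pi_gt0 R; lra.
by rewrite /f !fctE /= sin0 mul0r subrr subr_ge0.
Qed.

Lemma mul_cot_le1 (R : realType) (z : R) : z != 0 -> `|z| <= pi / 2 ->
  `|z * cot z| <= 1.
Proof.
move=> z0 zpi.
wlog zp : z z0 zpi / 0 < z.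
  move=> H; have [/H|] := ltP 0 z; first exact.
  rewrite le_eqVlt (negbTE z0) /= => zn.
  by rewrite -mulrNN -cotN H ?oppr_eq0 ?normrN // oppr_gt0.
rewrite gtr0_norm // in zpi.
have s0 : 0 < sin z by rewrite sin_gt0_pi // zp /=; have := @pi_gt0 R; lra.
have c0 : 0 <= cos z by rewrite cos_ge0_pihalf // zpi andbT; lra.
rewrite ger0_norm /cot; last by rewrite !mulr_ge0 // ?invr_ge0 ltW.
by rewrite mulrA ler_pdivrMr // mul1r le_mul_cos_sin // zpi ltW.
Qed.

Lemma mul_cot_cvg (R : realType) (z : nat -> R) :
  (forall m, z m != 0) -> z @ \oo --> (0 : R) ->
  (fun m => z m * cot (z m)) @ \oo --> (1 : R).
Proof.
move=> zn0 zc.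
have sc : (fun m => (z m)^-1 * sin (z m)) @ \oo --> (1 : R).
  have [ds sE] := is_derive_sin (0 : R).
  have : h^-1 *: (sin (h *: 1 + 0) - sin 0) @[h --> (0 : R)^'] --> (1 : R).
    by rewrite -[X in _ --> X]cos0 -sE.
  move=> /cvgr_dnbhsP /(_ z (conj zn0 zc)); apply: cvg_trans.
  apply: near_eq_cvg; near=> m.
  by rewrite /= sin0 subr0 addr0 /GRing.scale /= mulr1.
have cc : (fun m => cos (z m)) @ \oo --> (1 : R).
  rewrite -cos0; apply: continuous_cvg => //; exact: continuous_cos.
rewrite (_ : (fun m => z m * cot (z m)) =
    (fun m => cos (z m) * ((z m)^-1 * sin (z m))^-1)).
  rewrite -[X in _ --> X]mulr1 -[X in _ * X]invr1.
  by apply: cvgM => //; exact: cvgV.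
by apply/funext => m; rewrite /cot invfM invrK; ring.
Unshelve. all: by end_near. Qed.

(** * Passage to the limit in the dyadic sums *)

(** Dominated convergence for series: beyond a suitable index K, both the tail
of the limit series and the tails of the approximating sums are small, uniformly
in m, and finitely many terms converge together. *)
Lemma tannery (R : realType) (a : nat -> nat -> R) (b g : nat -> R)
    (N : nat -> nat) (l : R) :
  (forall i, a ^~ i @ \oo --> b i) ->
  (forall i, 0 <= g i) ->
  (forall m i, (i < N m)%N -> `|a m i| <= g i) ->
  cvgn (series g) -> series b @ \oo --> l ->
  (forall K, \forall m \near \oo, (K <= N m)%N) ->
  (fun m => \sum_(i < N m) a m i) @ \oo --> l.
Proof.
move=> ab g0 ag gc bl Noo; apply/cvgrPdist_lt => e e0.
have e3 : 0 < e / 3 by rewrite divr_gt0.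
have [K [Kg Kb]] : exists K, `|limn (series g) - series g K| < e / 3 /\
    `|l - series b K| < e / 3.
  have gK : \forall K \near \oo, `|limn (series g) - series g K| < e / 3.
    by have /cvgrPdist_lt : series g @ \oo --> limn (series g) := gc; apply.
  have bK : \forall K \near \oo, `|l - series b K| < e / 3.
    by have /cvgrPdist_lt := bl; apply.
  by near \oo => K; exists K; split; near: K.
have aK : (fun m => \sum_(0 <= i < K) a m i) @ \oo --> series b K.
  apply: cvg_big; first exact: add_continuous.
  by move=> i _; exact: ab.
near=> m.
have KN : (K <= N m)%N by near: m; exact: Noo.
have ha : `|series b K - \sum_(0 <= i < K) a m i| < e / 3.
  by near: m; move/cvgrPdist_lt: aK; apply.
rewrite -(big_mkord xpredT (a m)) (big_cat_nat (leq0n K) KN) //=.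
have ht : `|\sum_(K <= i < N m) a m i| < e / 3.
  apply: le_lt_trans (ler_norm_sum _ _ _) _.
  have : \sum_(K <= i < N m) `|a m i| <= \sum_(K <= i < N m) g i.
    by rewrite !big_nat; apply: ler_sum => i /andP[_ /ag].
  move=> /le_lt_trans; apply; rewrite -sub_series_geq //.
  apply: le_lt_trans Kg; apply: le_trans (ler_norm _); rewrite lerD2r.
  apply: nondecreasing_cvgn_le => //; apply: nondecreasing_series => i _ _.
  exact: g0.
set s := (X in `|series b K - X| < _) in ha *.
set t := (X in `|X| < _) in ht.
have -> : l - (s + t) = (l - series b K) + (series b K - s) - t by ring.
have := ler_normB ((l - series b K) + (series b K - s)) t.
have := ler_normD (l - series b K) (series b K - s).
lra.
Unshelve. all: by end_near. Qed.

(** The powers of z left over are positive except in the leading term, so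
z cot z alone governs the behaviour of this expression near the pole 0. *)
Lemma mul_cot_polyE (R : realType) (n : nat) (z : R) :
  z ^+ n.+1 * (cot_poly R n).[cot z] =
  \sum_(i < n.+2) (cot_poly R n)`_i * (z ^+ (n.+1 - i) * (z * cot z) ^+ i).
Proof.
rewrite (horner_coef_wide _ (size_cot_poly R n)) big_distrr /=.
apply: eq_bigr => i _; rewrite [(z * _) ^+ i]exprMn mulrCA; congr (_ * _).
by rewrite !mulrA -exprD subnK // -ltnS.
Qed.

Lemma mul_cot_poly_bounded (R : realType) (n : nat) :
  exists2 C : R, 0 <= C & forall z : R, z != 0 -> `|z| <= pi / 2 ->
    `|z ^+ n.+1 * (cot_poly R n).[cot z]| <= C.
Proof.
have p0 : 0 <= pi / 2 :> R by rewrite divr_ge0 // pi_ge0.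
exists (\sum_(i < n.+2) `|(cot_poly R n)`_i| * (pi / 2) ^+ (n.+1 - i)).
  by apply: sumr_ge0 => i _; rewrite mulr_ge0 // exprn_ge0.
move=> z z0 zp; rewrite mul_cot_polyE; apply: le_trans (ler_norm_sum _ _ _) _.
apply: ler_sum => i _; rewrite !normrM ler_wpM2l // -[leRHS]mulr1 !normrX.
by rewrite ler_pM ?exprn_ge0 ?lerXn2r ?nnegrE // exprn_ile1 // mul_cot_le1.
Qed.

Lemma mul_cot_poly_cvg (R : realType) (n : nat) (z : nat -> R) :
  (forall m, z m != 0) -> z @ \oo --> (0 : R) ->
  (fun m => z m ^+ n.+1 * (cot_poly R n).[cot (z m)]) @ \oo --> (1 : R).
Proof.
move=> z0 zc; under eq_fun do rewrite mul_cot_polyE.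
have -> : 1 = \sum_(i < n.+2)
    (cot_poly R n)`_i * ((0 : R) ^+ (n.+1 - i) * 1 ^+ i).
  rewrite big_ord_recr /= subnn !expr1n !mulr1 lead_cot_poly.
  rewrite big1 ?add0r // => i _.
  by rewrite expr0n subn_eq0 leqNgt ltn_ord /= mul0r mulr0.
apply: cvg_big => [|i _]; first exact: add_continuous.
apply: cvgM; first exact: cvg_cst.
apply: cvgM; first exact: continuous_cvg (@exprn_continuous R _ 0) zc.
exact: continuous_cvg (@exprn_continuous R i 1) (mul_cot_cvg z0 zc).
Qed.

(** The values c i stand for the points x + j of one half of the bilateral sum;
the bound on them keeps the arguments of cot in [- pi/2, pi/2]. *)
Lemma cot_poly_sum_cvg (R : realType) (n : nat) (c : nat -> R) (l : R) :
  (forall i, c i != 0) -> (forall i, `|c i| <= i.+1%:R) ->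
  cvgn (series (fun i => `|c i| ^- n.+1)) ->
  series (fun i => c i ^- n.+1) @ \oo --> l ->
  (fun m => (pi / 2 ^+ m.+1) ^+ n.+1 *
    \sum_(i < 2 ^ m) (cot_poly R n).[cot (c i * pi / 2 ^+ m.+1)]) @ \oo --> l.
Proof.
move=> c0 ci cc cl.
have [C C0 hC] := mul_cot_poly_bounded R n.
have q0 m : pi / 2 ^+ m.+1 != 0 :> R.
  by rewrite mulf_neq0 ?invr_neq0 ?expf_neq0 // gt_eqF // pi_gt0.
(* With z = pi c_i / 2^(m+1), the i-th term is c_i^(-n-1) z^(n+1) P_n(cot z),
   because (pi / 2^(m+1))^(n+1) = c_i^(-n-1) z^(n+1). *)
pose a m i := c i ^- n.+1 * ((c i * (pi / 2 ^+ m.+1)) ^+ n.+1 *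
  (cot_poly R n).[cot (c i * (pi / 2 ^+ m.+1))]).
rewrite (_ : (fun _ => _) = fun m => \sum_(i < 2 ^ m) a m i); last first.
  apply/funext => m; rewrite big_distrr /=; apply: eq_bigr => i _.
  by rewrite /a [(c i * _) ^+ _]exprMn !mulrA mulVf ?mul1r // expf_neq0.
apply: (@tannery R a _ (fun i => C * `|c i| ^- n.+1)) cl _.
- move=> i; rewrite -[X in _ --> X]mulr1;
    (apply: cvgM; first exact: cvg_cst).
  apply: mul_cot_poly_cvg => [m|]; first by rewrite mulf_neq0.
  rewrite -[X in _ --> X](mulr0 (c i));
    (apply: cvgM; first exact: cvg_cst).
  rewrite -[X in _ --> X](mulr0 pi);
    (apply: cvgM; first exact: cvg_cst).
  rewrite (_ : (fun m => _) = (fun m => 2^-1 * 2^-1 ^+ m)); last first.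
    by apply/funext => m; rewrite -exprS exprVn.
  rewrite -[X in _ --> X](mulr0 2^-1); apply: cvgM; first exact: cvg_cst.
  by apply: cvg_expr; rewrite ger0_norm //; lra.
- by move=> i; apply: mulr_ge0 => //; rewrite -exprVn exprn_ge0 // invr_ge0.
- move=> m i im; rewrite /a normrM normfV normrX mulrC ler_wpM2r //.
  apply: hC; first by rewrite mulf_neq0.
  rewrite normrM (ger0_norm (_ : 0 <= pi / 2 ^+ m.+1)); last first.
    by rewrite divr_ge0 ?exprn_ge0 // pi_ge0.
  rewrite mulrA ler_pdivrMr ?exprn_gt0 // exprS mulrA divfK ?pnatr_eq0 //.
  rewrite mulrC ler_wpM2l ?pi_ge0 // -natrX (le_trans (ci i)) //.
  by rewrite ler_nat.
- rewrite (_ : (fun i => _) = C *: (fun i => `|c i| ^- n.+1)) //.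
  exact: is_cvg_seriesZ.
- move=> K; near=> m; rewrite (leq_trans _ (ltnW (ltn_expl m _))) //.
  by near: m; exact: nbhs_infty_ge.
Unshelve. all: by end_near. Qed.

(** * Hurwitz zeta values *)

Lemma series_gt0 (R : realType) (u : nat -> R) :
  (forall i, 0 <= u i) -> 0 < u 0%N -> cvgn (series u) -> 0 < limn (series u).
Proof.
move=> u0 u00 cu.
have /lt_le_trans : 0 < series u 1 by rewrite /series /= big_nat1.
apply; apply: nondecreasing_cvgn_le => //.
by apply: nondecreasing_series => i _ _; exact: u0.
Qed.

Definition hurwitz (R : realType) (k : nat) (y : R) : R :=
  limn (series (fun i => (i%:R + y) ^- k)).

(** From the second term on, (z + 1)^(-k) <= 1 / (z (z + 1)), and this
bound telescopes. *)
Lemma cvg_hurwitz (R : realType) (k : nat) (y : R) : (1 < k)%N -> 0 < y ->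
  cvgn (series (fun i => (i%:R + y) ^- k)).
Proof.
move=> k1 y0.
have iy0 (i : nat) : 0 < i%:R + y by rewrite ltr_wpDl.
have u0 (i : nat) : 0 <= (i%:R + y) ^- k.
  by rewrite invr_ge0 exprn_ge0 // ltW.
have nd : nondecreasing_seq (series (fun i : nat => (i%:R + y) ^- k)).
  by apply: nondecreasing_series => i _ _; exact: u0.
apply: nondecreasing_is_cvgn => //.
exists (y ^- k + y^-1) => _ [n _ <-].
suff H : series (fun i : nat => (i%:R + y) ^- k) n.+1 <=
    y ^- k + y^-1 - (n%:R + y)^-1.
  apply: le_trans (nd n n.+1 (leqnSn n)) _; apply: le_trans H _.
  by rewrite gerBl invr_ge0 ltW.
elim: n => [|n IHn].
  by rewrite /series /= big_nat1 !add0r addrK.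
rewrite seriesSr; apply: le_trans (lerD IHn (lexx _)) _.
rewrite -addrA lerD2l -lerBrDl opprK [leRHS]addrC.
have -> : n.+1%:R + y = n%:R + y + 1 by rewrite -natr1 addrAC.
move: (n%:R + y) (iy0 n) => z z0.
apply: (@le_trans _ _ ((z + 1) ^- 2)).
  rewrite lef_pV2 ?posrE ?exprn_gt0 ?addr_gt0 //.
  by rewrite ler_eXn2l //; lra.
have -> : z^-1 - (z + 1)^-1 = (z * (z + 1))^-1.
  by field; rewrite !gt_eqF ?addr_gt0 ?ltr01.
rewrite lef_pV2 ?posrE ?exprn_gt0 ?mulr_gt0 ?addr_gt0 //.
by rewrite expr2 ler_wpM2r //; lra.
Qed.

Lemma hurwitz_gt0 (R : realType) (k : nat) (y : R) : (1 < k)%N -> 0 < y ->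
  0 < hurwitz k y.
Proof.
move=> k1 y0; apply: series_gt0; last exact: cvg_hurwitz.
  by move=> i; rewrite invr_ge0 exprn_ge0 // addr_ge0 // ltW.
by rewrite invr_gt0 exprn_gt0 // add0r.
Qed.

Lemma hurwitz_decreasing (R : realType) (k : nat) (y z : R) : (1 < k)%N ->
  0 < y -> y < z -> hurwitz k z < hurwitz k y.
Proof.
move=> k1 y0 yz; have z0 := lt_trans y0 yz.
have cy := cvg_hurwitz k1 y0; have cz := cvg_hurwitz k1 z0.
rewrite -subr_gt0 /hurwitz -lim_seriesB //; apply: series_gt0.
- move=> i; rewrite subr_ge0 lef_pV2 ?posrE ?exprn_gt0 ?ltr_wpDl //.
  apply: lerXn2r;
    by rewrite ?nnegrE ?lerD2l ?addr_ge0 ?(ltW y0) ?(ltW z0) ?(ltW yz).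
- rewrite subr_gt0 ltf_pV2 ?posrE ?exprn_gt0 ?ltr_wpDl //.
  by rewrite !add0r ltrXn2r ?nnegrE ?(ltW y0) ?(ltW z0) //; case: (k) k1.
- exact: is_cvg_seriesB.
Qed.

(** * Bilateral sums *)

(** Both halves are required to converge, which is what convergence of the
partial sums with independent ends amounts to. *)
Definition bilateral_sum (R : realType) (u : int -> R) (l : R) : Prop :=
  exists a b : R, [/\ series (fun i : nat => u (- i.+1%:Z)) @ \oo --> a,
    series (fun i : nat => u i%:Z) @ \oo --> b & l = a + b].

Lemma bilateral_sum_cvg (R : realType) (u : int -> R) (l : R) :
  bilateral_sum u l -> bipartial u @ (\oo, \oo) --> l.
Proof.
move=> [a [b [ua ub ->]]].
rewrite (_ : bipartial u = fun MN =>
    series (fun i : nat => u (- i.+1%:Z)) MN.1 +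
    series (fun i : nat => u i%:Z) MN.2); last first.
  by apply/funext => -[M N]; rewrite /bipartial /series /= !big_mkord.
apply: cvgD.
  exact: (cvg_comp _ _ cvg_fst ua).
exact: (cvg_comp _ _ cvg_snd ub).
Qed.

(** Translating the index by one moves the term u 0 from one half of the sum to
the other. *)
Lemma bilateral_sumS (R : realType) (u : int -> R) (l : R) :
  bilateral_sum u l <-> bilateral_sum (fun n => u (n + 1)) l.
Proof.
have negE m : series (fun i : nat => u (- i.+1%:Z + 1)) m.+1 =
    u 0 + series (fun i : nat => u (- i.+1%:Z)) m.
  rewrite /series /= big_nat_recl //; congr (_ + _).
  by apply: eq_bigr => i _; congr (u _); lia.
have posE m : series (fun i : nat => u i%:Z) m.+1 =
    u 0 + series (fun i : nat => u (i%:Z + 1)) m.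
  rewrite /series /= big_nat_recl //; congr (_ + _).
  by apply: eq_bigr => i _; congr (u _); lia.
have cvg1 (s t : nat -> R) c : (forall m, s m.+1 = u 0 + t m) ->
    s @ \oo --> c -> t @ \oo --> c - u 0.
  move=> st; rewrite -cvg_shiftS => sc.
  rewrite (_ : t = fun m => s m.+1 - u 0).
    by apply: cvgB => //; exact: cvg_cst.
  by apply/funext => m; rewrite st addrC addKr.
have cvg2 (s t : nat -> R) c : (forall m, s m.+1 = u 0 + t m) ->
    t @ \oo --> c -> s @ \oo --> c + u 0.
  move=> st tc; rewrite -cvg_shiftS.
  rewrite (_ : (fun m => s m.+1) = fun m => t m + u 0).
    by apply: cvgD => //; exact: cvg_cst.
  by apply/funext => m; rewrite st addrC.
split=> -[a [b [ua ub ->]]].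
  exists (a + u 0), (b - u 0); split; last by ring.
    exact: cvg2 negE ua.
  exact: cvg1 posE ub.
exists (a - u 0), (b + u 0); split; last by ring.
  exact: cvg1 negE ua.
exact: cvg2 posE ub.
Qed.

Lemma bilateral_sum_shift (R : realType) (u : int -> R) (m : int) (l : R) :
  bilateral_sum u l -> bilateral_sum (fun n => u (n + m)) l.
Proof.
move=> ul; elim/int_rec: m => [|m IHm|m IHm].
- by under eq_fun do rewrite addr0.
- move/bilateral_sumS: IHm; congr bilateral_sum.
  by apply/funext => n; congr (u _); lia.
- apply/bilateral_sumS; move: IHm; congr bilateral_sum.
  by apply/funext => n; congr (u _); lia.
Qed.

Lemma bilateral_sum_summable (R : realType) (u : int -> R) (l : R) :
  bilateral_sum (fun n => `|u n|) l ->
  summable [set: int] (fun n => (u n)%:E).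
Proof.
move=> [a [b [ua ub _]]]; rewrite /summable.
have half (e : nat -> int) (c : R) : injective e ->
    series (fun i => `|u (e i)|) @ \oo --> c ->
    (\esum_(n in range e) `|(u n)%:E| < +oo)%E.
  move=> einj uc; rewrite esum_image; last by move=> x y _ _; exact: einj.
  rewrite -nneseries_esumT //.
  have uc' : cvgn (series (fun i => `|u (e i)|)) by apply/cvg_ex; exists c.
  under eq_eseriesr do rewrite abse_EFin.
  rewrite (_ : (\sum_(i <oo) _)%E = (limn (series (fun i => `|u (e i)|)))%:E).
    exact: ltry.
  rewrite -EFin_lim //; congr (limn _).
  by apply/funext => n; rewrite /= /series /= sumEFin.
rewrite (esumID (range (fun i : nat => i%:Z))) //.
rewrite lte_add_pinfty //; rewrite setTI.
  by apply: half ub => i j [].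
rewrite (_ : ~` _ = range (fun i : nat => - i.+1%:Z)).
  by apply: half ua => i j; lia.
apply/seteqP; split => [n /= h|_ [i _ <-] [j _]]; last lia.
case: n h => n h; first by exfalso; apply: h; exists n.
by exists n => //; lia.
Qed.

(** * Sums of inverse powers as polynomials in cot *)

(** The negative half is summed by writing - (i + 1) + x = - (i + (1 - x)). *)
Lemma sum_inverse_powers (R : realType) (k : nat) (x : R) :
  (1 < k)%N -> 0 < x < 1 ->
  bilateral_sum (fun n => 1 / (n%:~R + x) ^+ k)
    ((-1) ^+ k * hurwitz k (1 - x) + hurwitz k x).
Proof.
move=> k1 /andP[x0 x1]; have y0 : 0 < 1 - x by rewrite subr_gt0.
exists ((-1) ^+ k * hurwitz k (1 - x)), (hurwitz k x); split => //.
  have c1 := cvg_hurwitz k1 y0.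
  rewrite (_ : (fun i : nat => _) =
      (-1) ^+ k *: (fun i => (i%:R + (1 - x)) ^- k)).
    by rewrite seriesZ; apply: cvgZl_tmp.
  apply/funext => i.
  rewrite [RHS](_ : _ = (-1) ^+ k * (i%:R + (1 - x)) ^- k) //.
  rewrite div1r -!exprVn -exprMn; congr (_ ^+ k).
  rewrite mulN1r -[RHS]invrN; congr (_^-1); rewrite mulrNz -pmulrn -natr1; ring.
rewrite (_ : (fun i : nat => _) = (fun i => (i%:R + x) ^- k)).
  exact: cvg_hurwitz.
by apply/funext => i; rewrite div1r.
Qed.

Lemma sum_abs_inverse_powers (R : realType) (k : nat) (x : R) :
  (1 < k)%N -> 0 < x < 1 ->
  bilateral_sum (fun n => `|1 / (n%:~R + x) ^+ k|)
    (hurwitz k (1 - x) + hurwitz k x).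
Proof.
move=> k1 /andP[x0 x1]; have y0 : 0 < 1 - x by rewrite subr_gt0.
exists (hurwitz k (1 - x)), (hurwitz k x); split => //.
  rewrite (_ : (fun i : nat => _) = (fun i => (i%:R + (1 - x)) ^- k)).
    exact: cvg_hurwitz.
  apply/funext => i; rewrite div1r normfV normrX; congr (_ ^- k).
  rewrite -normrN gtr0_norm; first by rewrite mulrNz -pmulrn -natr1; ring.
  rewrite mulrNz -pmulrn -natr1 opprD opprK; have := ler0n R i; lra.
rewrite (_ : (fun i : nat => _) = (fun i => (i%:R + x) ^- k)).
  exact: cvg_hurwitz.
apply/funext => i; rewrite div1r ger0_norm // invr_ge0 exprn_ge0 //.
by rewrite addr_ge0 // ltW.
Qed.

(** The expressions of pi^k P_n(cot(pi x)) as finite sums form a constant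
sequence, so it equals the limit of these sums, computed on each half. *)
Lemma hurwitz_reflection (R : realType) (n : nat) (x : R) :
  (0 < n)%N -> 0 < x < 1 ->
  (-1) ^+ n.+1 * hurwitz n.+1 (1 - x) + hurwitz n.+1 x =
  pi ^+ n.+1 * (cot_poly R n).[cot (x * pi)].
Proof.
move=> n0 x01; have [x0 x1] := andP x01.
have [a [b [ua ub ->]]] := sum_inverse_powers (n0 : (1 < n.+1)%N) x01.
have [a' [b' [va vb _]]] := sum_abs_inverse_powers (n0 : (1 < n.+1)%N) x01.
have norm_series (c : nat -> R) (d : R) :
    series (fun i => `|1 / c i ^+ n.+1|) @ \oo --> d ->
    cvgn (series (fun i => `|c i| ^- n.+1)).
  move=> cd; apply/cvg_ex; exists d; move: cd.
  by under eq_fun do rewrite div1r normfV normrX.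
have inv_series (c : nat -> R) (d : R) :
    series (fun i => 1 / c i ^+ n.+1) @ \oo --> d ->
    series (fun i => c i ^- n.+1) @ \oo --> d.
  by under eq_fun do rewrite div1r.
have la := @cot_poly_sum_cvg R n (fun i => (- i.+1%:Z)%:~R + x) a _ _
  (norm_series _ _ va) (inv_series _ _ ua).
have lb := @cot_poly_sum_cvg R n (fun i => i%:Z%:~R + x) b _ _
  (norm_series _ _ vb) (inv_series _ _ ub).
have cE i : (- i.+1%:Z)%:~R = - i%:R - 1 :> R.
  by rewrite mulrNz -pmulrn -natr1 opprD.
have {}la := la _ _; have {}lb := lb _ _.
have lab : (fun m : nat =>
    pi ^+ n.+1 * (cot_poly R n).[cot (x * pi)]) @ \oo --> a + b.
  rewrite (_ : (fun _ => _) = fun m =>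
    (pi / 2 ^+ m.+1) ^+ n.+1 * (\sum_(i < 2 ^ m)
      (cot_poly R n).[cot (((- i.+1%:Z)%:~R + x) * pi / 2 ^+ m.+1)]) +
    (pi / 2 ^+ m.+1) ^+ n.+1 * (\sum_(i < 2 ^ m)
      (cot_poly R n).[cot ((i%:Z%:~R + x) * pi / 2 ^+ m.+1)])).
    apply: cvgD.
      apply: la => i; first by rewrite cE lt_eqF //; have := ler0n R i; lra.
      rewrite cE -normrN ger0_norm -?natr1; have := ler0n R i; lra.
    apply: lb => i; first by rewrite gt_eqF // ltr_wpDl.
    by rewrite ger0_norm ?addr_ge0 ?(ltW x0) // -natr1 lerD2l ltW.
  apply/funext => m; rewrite -mulrDr.
  have hy : 0 < x * pi < pi.
    by rewrite mulr_gt0 ?pi_gt0 //= gtr_pMl ?pi_gt0.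
  have := cot_poly_sum_sym n m hy; set s := (X in X = _) => sE.
  rewrite [X in _ = _ * X](_ : _ = s).
    by rewrite sE mulrA -exprMn divfK // expf_neq0 // pnatr_eq0.
  rewrite /s; congr (_ + _); apply: eq_bigr => i _; congr (_.[cot (_ / _)]).
    by rewrite cE -natr1; ring.
  by rewrite -pmulrn; ring.
exact: cvg_unique (lab) (cvg_cst _).
Qed.

(** * Algebraicity of cot at rational multiples of pi *)

Lemma algebraic_horner (R : realType) (p : {poly rat}) (c : R) :
  algebraic_number c -> algebraic_number (map_poly ratr p).[c].
Proof.
rewrite /algebraic_number !integral_algebraic; apply: integral_horner.
by apply/integral_poly => i; rewrite coef_map; exact: integral_id.
Qed.

(** A and B are the real and imaginary parts of (X + i)^n, since
cos t + i sin t = sin t (cot t + i). *)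
Lemma multiple_angle_polys (n : nat) : exists A B : {poly rat},
  forall (R : realType) (t : R), sin t != 0 ->
    cos (t *+ n) = sin t ^+ n * (map_poly ratr A).[cot t] /\
    sin (t *+ n) = sin t ^+ n * (map_poly ratr B).[cot t].
Proof.
elim: n => [|n [A [B AB]]].
  exists 1, 0 => R t _.
  rewrite !mulr0n cos0 sin0 rmorph1 rmorph0 hornerC horner0.
  by rewrite expr0 mulr0 mulr1.
exists (A * 'X - B), (A + B * 'X) => R t st; have [cE sE] := AB R t st.
rewrite !mulrSr cosD sinD cE sE rmorphB rmorphD !rmorphM /= map_polyX.
rewrite !hornerE /= /cot exprS.
by split; field.
Qed.

(** With d the denominator of q, sin(d q pi) = 0, so cot(q pi) is a root of the
polynomial B of the multiple angle formula. *)
Lemma algebraic_cot (R : realType) (q : rat) : 0 < q < 1 ->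
  algebraic_number (cot (ratr q * pi : R)).
Proof.
move=> /andP[q0 q1]; pose d := `|denq q|%N; pose a := `|numq q|%N.
have d0 : (0 < d)%N by rewrite absz_gt0 denq_neq0.
have qd : ratr q * d%:R = a%:R :> R.
  rewrite /ratr !pmulrn gez0_abs ?denq_ge0 // gez0_abs; last first.
    by rewrite numq_ge0 ltW.
  by rewrite -mulrA mulVf ?mulr1 // intr_eq0 denq_neq0.
have p0 : 0 < pi :> R := pi_gt0 R.
have [A [B AB]] := multiple_angle_polys d.
exists B.
  (* B is nonzero since sin(d t) = 1 at t = pi / (2 d). *)
  pose t : R := pi / 2 / d%:R.
  have st : sin t != 0.
    rewrite gt_eqF // sin_gt0_pi // !divr_gt0 ?ltr0n //=.
    rewrite ltr_pdivrMr ?ltr0n //.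
    have : 1 <= d%:R :> R by rewrite ler1n.
    by nra.
  have [_] := AB R t st.
  rewrite -[t *+ d]mulr_natr /t divfK ?pnatr_eq0 -?lt0n // sin_pihalf.
  apply: contra_eq_neq => ->.
  by rewrite rmorph0 horner0 mulr0 oner_eq0.
have sq : 0 < sin (ratr q * pi : R).
  rewrite sin_gt0_pi // mulr_gt0 ?ltr0q //=.
  by rewrite gtr_pMl // -[ltRHS](rmorph1 (@ratr R)) ltr_rat.
have [_] := AB R _ (lt0r_neq0 sq).
rewrite -mulr_natr mulrAC qd mulr_natl.
have -> : sin (pi *+ a) = 0 :> R.
  elim: (a) => [|m IHm]; first by rewrite sin0.
  by rewrite mulrSr sinDpi IHm oppr0.
by move=> /esym /eqP; rewrite mulf_eq0 expf_eq0 (gt_eqF sq) andbF.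
Qed.

(** * Reduction to the unit interval and zeros of the sum *)

Lemma int_translate (alpha : rat) : alpha \isn't a Num.int ->
  exists (m : int) (q : rat), alpha = q + m%:~R /\ 0 < q < 1.
Proof.
move=> alphaN; exists (Num.floor alpha), (alpha - (Num.floor alpha)%:~R).
split; first by rewrite subrK.
have := Num.Theory.floor_itv alpha.
rewrite /= intrD => /andP[].
rewrite le_eqVlt => /orP[/eqP E|]; last lra.
by move: alphaN; rewrite -E intr_int.
Qed.

Lemma half_integer_translate (q : rat) (m : int) : 0 < q < 1 ->
  half_integer (q + m%:~R) <-> q = 1 / 2.
Proof.
move=> /andP[q0 q1]; split=> [[p qp]|->]; last by exists m; rewrite addrC.
have pm : q = (p - m)%:~R + 1 / 2 by rewrite intrB; move: qp; lra.
have h1 : (-1)%:~R < (p - m)%:~R :> rat by rewrite rmorphN /=; lra.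
have h2 : (p - m)%:~R < 1%:~R :> rat by rewrite /=; lra.
rewrite !ltr_int in h1 h2.
have E : p - m = 0 by lia.
by rewrite pm E add0r.
Qed.

Lemma hurwitz_reflection_eq0 (R : realType) (k : nat) (x : R) :
  (1 < k)%N -> 0 < x < 1 ->
  (-1) ^+ k * hurwitz k (1 - x) + hurwitz k x = 0 <-> odd k /\ x = 1 / 2.
Proof.
move=> k1 /andP[x0 x1]; have y0 : 0 < 1 - x by rewrite subr_gt0.
have hx := hurwitz_gt0 k1 x0; have hy := hurwitz_gt0 k1 y0.
rewrite -signr_odd; case: (odd k) => /=; last first.
  by rewrite expr0 mul1r; split=> [|[]//]; lra.
rewrite expr1 mulN1r; split=> [E|[_ ->]]; last first.
  by rewrite (_ : 1 - 1 / 2 = 1 / 2) ?addNr //; lra.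
split=> //; case: (ltgtP x (1 / 2)) => // h.
  have /(hurwitz_decreasing k1 x0) : x < 1 - x by lra.
  lra.
have /(hurwitz_decreasing k1 y0) : 1 - x < x by lra.
lra.
Qed.

Theorem corollary1 (R : realType) (k : nat) (alpha : rat)
    (hk : (1 < k)%N) (halpha : alpha \isn't a Num.int) :
  let u : int -> R := shifted_term R k alpha in
  [/\ summable [set: int] (fun n => (u n)%:E),
      bicvg u,
      bisum u = 0 \/
        (exists2 a : R, algebraic_number a & bisum u = a * pi ^+ k)
    & bisum u = 0 <-> odd k /\ half_integer alpha].
Proof.
have [m [q [-> q01]]] := int_translate halpha.
move=> u; set x : R := ratr q.
have x01 : 0 < x < 1.
  have /andP[q0 q1] := q01.
  by rewrite ltr0q q0 /= -[ltRHS](rmorph1 (@ratr R)) ltr_rat.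
have uE n : u n = 1 / ((n + m)%:~R + x) ^+ k.
  rewrite /u /shifted_term rmorphD /= ratr_int intrD /x.
  by congr (1 / _ ^+ _); ring.
have us : bilateral_sum u ((-1) ^+ k * hurwitz k (1 - x) + hurwitz k x).
  rewrite (funext uE).
  exact: (bilateral_sum_shift m (sum_inverse_powers hk x01)).
have ua : bilateral_sum (fun n => `|u n|) (hurwitz k (1 - x) + hurwitz k x).
  under eq_fun do rewrite uE.
  exact: (bilateral_sum_shift m (sum_abs_inverse_powers hk x01)).
have uc := bilateral_sum_cvg us.
have -> : bisum u = (-1) ^+ k * hurwitz k (1 - x) + hurwitz k x.
  exact: cvg_lim uc.
split.
- exact: bilateral_sum_summable ua.
- by apply/cvg_ex; eexists; exact: uc.
- right; exists (cot_poly R k.-1).[cot (x * pi)].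
    rewrite -(map_cot_poly ratr); apply: algebraic_horner.
    exact: algebraic_cot.
  by case: k hk {u uE us ua uc} => // n n0; rewrite hurwitz_reflection // mulrC.
- rewrite hurwitz_reflection_eq0 //.
  have xq : x = 1 / 2 <-> q = 1 / 2.
    have -> : 1 / 2 = ratr (1 / 2) :> R.
      by rewrite rmorphM fmorphV rmorph_nat rmorph1.
    by rewrite /x; split=> [/fmorph_inj|->].
  by rewrite xq half_integer_translate.
Qed.
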